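(* Let $S = R \cup B$ be a set of $2n$ points in general position (no three collinear) in the plane, where $R$ is the set of red points, $B$ the set of blue points, and $|R| = |B| = n$. Then $S$ has at least $\frac{n^2-4n}{12}$ balanced $4$-holes.
   Context: A hole of $S$ is a simple polygon $Q$ whose vertices are points of $S$ and whose interior contains no point of $S$; a $k$-hole is a hole with $k$ vertices. Holes need not be convex. A $4$-hole is balanced if it has exactly two red and two blue vertices. *)

(* Defs.v *)
From mathcomp Require Import all_boot all_order all_algebra.
From mathcomp Require Import all_classical all_reals all_analysis.
Set Implicit Arguments. Unset Strict Implicit. Unset Printing Implicit Defensive.
Import Order.TTheory GRing.Theory Num.Theory.
Import numFieldNormedType.Exports.
Local Open Scope ring_scope.
Local Open Scope classical_set_scope.

Section Geometry.
Variable R : realType.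
Notation pt := (R * R)%type.

Definition orient (a b c : pt) : R :=
  (b.1 - a.1) * (c.2 - a.2) - (b.2 - a.2) * (c.1 - a.1).

Definition general_position (S : seq pt) : Prop :=
  uniq S /\ forall a b c, a \in S -> b \in S -> c \in S ->
    a != b -> b != c -> a != c -> orient a b c != 0.

Definition on_seg (a b p : pt) : Prop :=
  exists t : R, 0 <= t <= 1 /\ p = (a.1 + t * (b.1 - a.1), a.2 + t * (b.2 - a.2)).

Definition vtx (P : seq pt) (i : nat) : pt := nth (0, 0) P (i %% size P).
Definition on_edge (P : seq pt) (i : nat) (p : pt) : Prop :=
  on_seg (vtx P i) (vtx P i.+1) p.

Definition boundary (P : seq pt) : set pt :=
  [set p | exists2 i, (i < size P)%N & on_edge P i p].

Definition simple_polygon (P : seq pt) : Prop :=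
  (3 <= size P)%N /\ uniq P /\
  forall i j, (i < j < size P)%N -> forall p, on_edge P i p -> on_edge P j p ->
    (j == i.+1 /\ p = vtx P j) \/ (i == 0%N /\ j == (size P).-1 /\ p = vtx P 0).

(* interior of a simple polygon: points off the boundary whose connected
   component in the complement of the boundary is bounded (Jordan interior) *)
Definition bounded_pts (A : set pt) : Prop :=
  exists M : R, forall q, A q -> `|q.1| <= M /\ `|q.2| <= M.
Definition interior_polygon (P : seq pt) : set pt :=
  [set p | ~ boundary P p /\ bounded_pts (@connected_component (R * R)%type (~` boundary P) p)].

Definition is_hole (S : seq pt) (P : seq pt) : Prop :=
  simple_polygon P /\ all (fun v => v \in S) P /\
  forall s, s \in S -> ~ interior_polygon P s.
Definition is_k_hole (k : nat) (S : seq pt) (P : seq pt) : Prop :=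
  size P = k /\ is_hole S P.

Definition balanced_4hole (Rd Bl : seq pt) (P : seq pt) : Prop :=
  is_k_hole 4 (Rd ++ Bl) P /\ count (fun v => v \in Rd) P = 2%N /\
  count (fun v => v \in Bl) P = 2%N.

Definition same_polygon (P Q : seq pt) : Prop :=
  exists k, Q = rot k P \/ Q = rot k (rev P).

End Geometry.

(* Main.v *)
Require Import Defs.
From mathcomp Require Import all_boot all_order all_algebra.
From mathcomp Require Import all_classical all_reals all_analysis.
From mathcomp Require Import ring lra zify.
Set Implicit Arguments. Unset Strict Implicit. Unset Printing Implicit Defensive.
Import Order.TTheory GRing.Theory Num.Theory.
Import numFieldNormedType.Exports.
Local Open Scope ring_scope.
Local Open Scope classical_set_scope.

(** Call a bichromatic pair [(r, b)] good if some balanced 4-hole has both as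
    vertices; a balanced 4-hole contains four bichromatic pairs, so it is enough
    to find [(n^2 - 4 n) / 3] good pairs.

    If two points of different colours both span an empty triangle with [r b],
    the pair is good: from opposite sides of [r b] the two triangles form a hole,
    and on the same side a closest such pair of points spans an empty convex
    quadrilateral with [r b]. So for a bad pair all these apices have one
    colour, say that of [r]. Then for every other point [b'] of the colour of [b],
    the triangle [r b b'] contains at least three points of the colour of [r]:
    shrink it until no other point of the colour of [b] is inside; if it then
    contained one or two points, one of them would split off a balanced 4-hole
    through [r] and [b]. Sorting around [r] the points [b] that are bad in this
    sense, [f] of them give [f - 1] disjoint triangles, whence
    [3 (f - 1) <= n - 1]. Summing over all [r] of both colours leaves at most
    [2 n (n + 2) / 3] bad pairs. *)

(** * Minima and counting in finite sequences *)

Lemma seq_argmin (R : realType) (T : eqType) (f : T -> R) (P : pred T) (s : seq T) :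
  has P s ->
  exists x, [/\ x \in s, P x & forall y, y \in s -> P y -> f x <= f y].
Proof.
elim: s => //= z s IH; have [Ps _|Ps] := boolP (has P s).
  have [x [xs Px xmin]] := IH Ps.
  have [Pz|nPz] := boolP (P z); last first.
    exists x; split=> //; first by rewrite inE xs orbT.
    by move=> y; rewrite inE => /predU1P[->|/xmin]; first by rewrite (negbTE nPz).
  have [zx|xz] := leP (f z) (f x).
    exists z; split=> //; first exact: mem_head.
    by move=> y; rewrite inE => /predU1P[->//|ys Py]; apply: (le_trans zx); exact: xmin.
  exists x; split=> //; first by rewrite inE xs orbT.
  by move=> y; rewrite inE => /predU1P[->|/xmin//]; rewrite (ltW xz).
rewrite orbF => Pz; exists z; split=> //; first exact: mem_head.
move=> y; rewrite inE => /predU1P[->//|ys Py].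
by case/hasP: Ps; exists y.
Qed.

Lemma perm_quad (T : eqType) (u v w x : T) :
  [/\ perm_eq [:: u; v; x; w] [:: u; v; w; x],
      perm_eq [:: w; u; x; v] [:: u; v; w; x],
      perm_eq [:: v; w; x; u] [:: u; v; w; x]
    & perm_eq [:: v; u; w; x] [:: u; v; w; x]].
Proof. by split; apply/permP => P /=; ring. Qed.

Lemma mem_cons_tail (T : eqType) {x y : T} {s} : y \in s -> y \in x :: s.
Proof. by rewrite inE orbC => ->. Qed.

Lemma count_disjoint (T : Type) (P1 P2 P3 : pred T) (s : seq T) :
  subpred P1 P3 -> subpred P2 P3 -> (forall x, ~~ (P1 x && P2 x)) ->
  (count P1 s + count P2 s <= count P3 s)%N.
Proof.
move=> s1 s2 d; rewrite -count_predUI (eq_count (a1 := predI P1 P2) (a2 := pred0)).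
  by rewrite count_pred0 addn0; apply: sub_count => x /= /orP[/s1|/s2].
by move=> x /=; exact: negbTE.
Qed.

Lemma sub_in_count (T : eqType) (P1 P2 : pred T) (s : seq T) :
  {in s, subpred P1 P2} -> (count P1 s <= count P2 s)%N.
Proof.
move=> h; rewrite (@eq_in_count _ P1 (predI P1 P2)); last first.
  by move=> x xs /=; case P1x: (P1 x) => //=; rewrite (h x xs P1x).
by apply: sub_count => x /= /andP[].
Qed.

Lemma count_mem_le (T : eqType) (s t : seq T) : uniq s ->
  (count (mem t) s <= count (mem s) t)%N.
Proof.
move=> us; rewrite -!size_filter; apply: uniq_leq_size; first exact: filter_uniq.
by move=> x; rewrite !mem_filter /= andbC.
Qed.

Lemma sum_nat_of_bool (T : Type) (P : pred T) (s : seq T) :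
  (\sum_(x <- s) P x)%N = count P s.
Proof. by elim: s => [|x s IH]; rewrite ?big_nil ?big_cons ?IH. Qed.

(** * Counting reals in the gaps between sorted keys *)

Section Gaps.
Variable R : realType.
Implicit Types (K Y : seq R) (k y : R).

(** The open intervals between consecutive keys are disjoint, so their counts add up along the
    path. *)
Lemma path_gaps k0 K Y : path <%R k0 K ->
  {in k0 :: K &, forall k k', k < k' -> (3 <= count (fun y => (k < y < k')%R) Y)%N} ->
  (3 * size K <= count (fun y => (k0 < y < last k0 K)%R) Y)%N.
Proof.
elim: K k0 => [|k1 K IH] k0 /=; first by rewrite muln0.
case/andP=> k01 pK gap.
have {}IH := IH k1 pK (fun k k' hk hk' => gap k k' (mem_cons_tail hk) (mem_cons_tail hk')).
have g0 := gap k0 k1 (mem_head _ _) (mem_cons_tail (mem_head _ _)) k01.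
have kl : k1 <= last k1 K.
  have := mem_last k1 K; rewrite inE => /predU1P[->//|lK].
  by have /allP/(_ _ lK)/ltW := order_path_min lt_trans pK.
rewrite mulnS; apply: leq_trans (leq_add g0 IH) _; apply: count_disjoint => y.
- by case/andP=> -> /lt_le_trans; apply.
- by case/andP=> /(lt_trans k01) -> ->.
- by apply/negP => /andP[/andP[_ h1] /andP[h2 _]]; have := lt_trans h1 h2; rewrite ltxx.
Qed.

(** After sorting, [m] keys leave only [m - 1] bounded gaps; the interval unbounded below, to the
    left of the least key, supplies the missing three elements. *)
Lemma three_per_gap K Y : uniq K ->
  {in K, forall k, (3 <= count (fun y => (y < k)%R) Y)%N} ->
  {in K &, forall k k', k < k' -> (3 <= count (fun y => (k < y < k')%R) Y)%N} ->
  (3 * size K <= size Y)%N.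
Proof.
move=> uK g0 g1; rewrite -(size_sort <=%R K).
have sK : sorted <%R (sort <=%R K) by rewrite lt_sorted_uniq_le sort_uniq uK sort_le_sorted.
have memK : sort <=%R K =i K by exact: mem_sort.
case: (sort _ _) sK memK => [|k0 K'] // sK memK; rewrite /= mulnS.
have h : {in k0 :: K' &, forall k k', k < k' -> (3 <= count (fun y => (k < y < k')%R) Y)%N}.
  by move=> k k'; rewrite !memK; exact: g1.
have /g0 h0 : k0 \in K by rewrite -memK mem_head.
apply: leq_trans (leq_add h0 (path_gaps sK h)) _.
rewrite -(count_predT Y); apply: count_disjoint => // y.
by apply/negP => /andP[h1 /andP[h2 _]]; have := lt_trans h1 h2; rewrite ltxx.
Qed.
End Gaps.

(** * Orientation and closed triangles *)

Section Geometry.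
Variable R : realType.
Notation pt := (R * R)%type.
Implicit Types a b c d p q s x y : pt.

Lemma orient_rot a b c : orient b c a = orient a b c.
Proof. rewrite /orient; ring. Qed.

Lemma orient_swap a b c : orient b a c = - orient a b c.
Proof. rewrite /orient; ring. Qed.

Lemma orient_swapr a b c : orient a c b = - orient a b c.
Proof. rewrite /orient; ring. Qed.

Lemma orient_xyx x y : orient x y x = 0.
Proof. by rewrite /orient; ring. Qed.

Lemma orient_xyy x y : orient x y y = 0.
Proof. by rewrite /orient; ring. Qed.

Lemma orient_split p a b c :
  orient a b c = orient a b p + orient b c p + orient c a p.
Proof. rewrite /orient; ring. Qed.

(** Barycentric coordinates without division: [orient x y] is affine, so its value at [p] is the
    combination of its values at the vertices weighted by the areas of the opposite subtriangles. *)
Lemma orient_bary a b c p x y :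
  orient a b c * orient x y p =
  orient b c p * orient x y a + orient c a p * orient x y b
  + orient a b p * orient x y c.
Proof. rewrite /orient; ring. Qed.

(** The factor [orient a b c] makes the test independent of the orientation of the triangle. For
    collinear [a], [b], [c] every point passes, hence the nondegeneracy hypotheses below. *)
Definition in_tri a b c p : bool :=
  [&& 0 <= orient a b c * orient a b p, 0 <= orient a b c * orient b c p
    & 0 <= orient a b c * orient c a p].

Lemma in_tri_rot a b c p : in_tri b c a p = in_tri a b c p.
Proof. by rewrite /in_tri (orient_rot a b c) andbA [RHS]andbC. Qed.

Lemma in_tri_swap a b c p : in_tri b a c p = in_tri a b c p.
Proof.
rewrite /in_tri (orient_swap a b c) (orient_swap a b p) (orient_swap c a p).
rewrite (orient_swap b c p) !mulrNN.
by congr (_ && _); rewrite andbC.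
Qed.

Lemma in_tri1 a b c : in_tri a b c a.
Proof.
have -> : in_tri a b c a = (0 <= orient a b c * orient a b c).
  by rewrite /in_tri (orient_rot a b c) orient_xyx orient_xyy mulr0 lexx /= andbT.
exact: sqr_ge0.
Qed.

Lemma in_tri2 a b c : in_tri a b c b.
Proof. by rewrite -in_tri_rot in_tri1. Qed.

Lemma in_tri3 a b c : in_tri a b c c.
Proof. by rewrite -in_tri_rot in_tri2. Qed.

(** Convexity of a half-plane: by [orient_bary] the value at [p] is a nonnegative combination of the
    values at the vertices. The sign of [k] selects the side of the line [x y]. *)
Lemma in_tri_half a b c p x y k : orient a b c != 0 -> in_tri a b c p ->
  0 <= k * orient x y a -> 0 <= k * orient x y b -> 0 <= k * orient x y c ->
  0 <= k * orient x y p.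
Proof.
move=> D0 /and3P[h1 h2 h3] ka kb kc.
have D2 : 0 < orient a b c ^+ 2 by rewrite exprn_even_gt0.
rewrite -(pmulr_rge0 _ D2).
have -> : orient a b c ^+ 2 * (k * orient x y p) =
  (orient a b c * orient b c p) * (k * orient x y a)
  + (orient a b c * orient c a p) * (k * orient x y b)
  + (orient a b c * orient a b p) * (k * orient x y c).
  transitivity (orient a b c * k * (orient a b c * orient x y p)); first by ring.
  by rewrite orient_bary; ring.
by rewrite !addr_ge0 // mulr_ge0.
Qed.

Lemma in_tri_pos a b c p : 0 < orient a b c ->
  in_tri a b c p = [&& 0 <= orient a b p, 0 <= orient b c p & 0 <= orient c a p].
Proof. by move=> D0; rewrite /in_tri !pmulr_rge0. Qed.

Lemma in_tri_halfpos a b c p x y : 0 < orient a b c -> in_tri a b c p ->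
  0 <= orient x y a -> 0 <= orient x y b -> 0 <= orient x y c ->
  0 <= orient x y p.
Proof.
move=> D0 h; rewrite -[orient x y a]mul1r -[orient x y b]mul1r -[orient x y c]mul1r.
by rewrite -[orient x y p]mul1r; apply: in_tri_half h; rewrite gt_eqF.
Qed.

Lemma in_tri_trans a b c x y z p : orient x y z != 0 ->
  in_tri a b c x -> in_tri a b c y -> in_tri a b c z ->
  in_tri x y z p -> in_tri a b c p.
Proof.
move=> D0 /and3P[x1 x2 x3] /and3P[y1 y2 y3] /and3P[z1 z2 z3] hp.
by apply/and3P; split; apply: (in_tri_half D0 hp).
Qed.

Lemma in_tri_seg a b c p : on_seg a b p -> in_tri a b c p.
Proof.
case=> t [/andP[t0 t1] ->].
have sq : 0 <= orient a b c * orient a b c by exact: sqr_ge0.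
set q := (_, _).
have e1 : orient a b q = 0 by rewrite /orient /=; ring.
have e2 : orient b c q = (1 - t) * orient a b c by rewrite /orient /=; ring.
have e3 : orient c a q = t * orient a b c by rewrite /orient /=; ring.
rewrite /in_tri e1 e2 e3 mulr0 lexx /= !(mulrCA (orient a b c)).
by apply/andP; split; apply: mulr_ge0 => //; rewrite subr_ge0.
Qed.

(** * Rays that leave a triangle and every bounded set *)

Definition ray a s (t : R) : pt := (a.1 + t * (s.1 - a.1), a.2 + t * (s.2 - a.2)).

(** The triangle is star-shaped around [a], and [s] lies between [a] and [ray a s t] when [t] is at
    least 1. *)
Lemma in_tri_ray a b c s t : 1 <= t -> in_tri a b c (ray a s t) -> in_tri a b c s.
Proof.
move=> t1; rewrite /in_tri.
have e1 : orient a b (ray a s t) = t * orient a b s by rewrite /orient /=; ring.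
have e3 : orient c a (ray a s t) = t * orient c a s by rewrite /orient /=; ring.
have e2 : orient b c (ray a s t) = t * orient b c s - (t - 1) * orient a b c.
  by rewrite /orient /=; ring.
have t0 : 0 < t by lra.
rewrite e1 e2 e3 => /and3P[h1 h2 h3].
have sq : 0 <= orient a b c * orient a b c by exact: sqr_ge0.
have h4 : 0 <= (t - 1) * (orient a b c * orient a b c).
  by apply: mulr_ge0 => //; rewrite subr_ge0.
by apply/and3P; split; rewrite -(pmulr_rge0 _ t0); lra.
Qed.

Lemma ray_continuous a s : continuous (ray a s : R -> (R * R)%type).
Proof.
have aff (u v t : R) : u + x * v @[x --> t] --> u + t * v.
  by apply: cvgD; [exact: cvg_cst|apply: cvgM; [exact: cvg_id|exact: cvg_cst]].
by move=> t; exact: (cvg_pair (aff a.1 _ t) (aff a.2 _ t)).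
Qed.

Lemma connected_ray a s : connected (ray a s @` `[1, +oo[).
Proof.
apply: connected_continuous_connected.
  by apply/connected_intervalP; exact: interval_is_interval.
by apply: continuous_subspaceT; exact: ray_continuous.
Qed.

Lemma ray_unbounded a s : s != a -> ~ bounded_pts (ray a s @` `[1, +oo[).
Proof.
move=> sa [M hM].
have M0 : 0 <= M.
  have [|+ _] := hM (ray a s 1); first by exists 1; rewrite //= in_itv /= lexx.
  exact: le_trans.
have nrm (u v : R) : v != 0 -> exists2 t, 1 <= t & M < `|u + t * v|.
  move=> v0; have v1 : 0 < `|v| by rewrite normr_gt0.
  (* With this [t] the absolute value of [t * v] is [|v| + M + 1 + |u|], which still exceeds [M]
     after [|u|] is subtracted. *)
  exists (1 + (M + 1 + `|u|) / `|v|).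
    by rewrite lerDl divr_ge0 // !addr_ge0.
  have -> : u + (1 + (M + 1 + `|u|) / `|v|) * v
     = (1 + (M + 1 + `|u|) / `|v|) * v - (- u) by ring.
  apply: lt_le_trans (lerB_dist _ _); rewrite normrN normrM.
  rewrite (ger0_norm (_ : 0 <= 1 + _)); last by rewrite addr_ge0 // divr_ge0 // !addr_ge0.
  by rewrite mulrDl divfK ?gt_eqF //; lra.
have inr t : 1 <= t -> (ray a s @` `[1, +oo[) (ray a s t).
  by move=> t1; exists t => //=; rewrite in_itv /= t1.
have [e1|n1] := eqVneq (s.1 - a.1) 0; last first.
  by have [t t1] := nrm a.1 _ n1; have [h _] := hM _ (inr t t1); rewrite ltNge h.
have [e2|n2] := eqVneq (s.2 - a.2) 0; last first.
  by have [t t1] := nrm a.2 _ n2; have [_ h] := hM _ (inr t t1); rewrite ltNge h.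
case/eqP: sa; rewrite (surjective_pairing s) (surjective_pairing a).
by rewrite (subr0_eq e1) (subr0_eq e2).
Qed.

(** * Simple quadrilaterals *)

Lemma seg_meet x y z p : orient x y z != 0 ->
  on_seg x y p -> on_seg y z p -> p = y.
Proof.
move=> D0 [t [_ ep]] [u [_ eq]].
have e1 : orient x y p = 0 by rewrite ep /orient /=; ring.
have e2 : orient x y p = u * orient x y z by rewrite eq /orient /=; ring.
have u0 : u = 0.
  apply/eqP; move: e2; rewrite e1 => /esym/eqP.
  by rewrite mulf_eq0 (negbTE D0) orbF.
by rewrite eq u0 !mul0r !addr0 -surjective_pairing.
Qed.

(** The two sides of the equation would have opposite signs. This confines the common points of
    edges on opposite sides of a diagonal to the line through it. *)
Lemma opposite_coef_eq0 (k l t u : R) : k * l < 0 -> 0 <= t -> 0 <= u ->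
  t * k = u * l -> t = 0 /\ u = 0.
Proof.
move=> kl t0 u0 e.
have k0 : k != 0 by apply: contraTneq kl => ->; rewrite mul0r ltxx.
have l0 : l != 0 by apply: contraTneq kl => ->; rewrite mulr0 ltxx.
have k2 : 0 < k ^+ 2 by rewrite exprn_even_gt0.
have u1 : 0 <= u * - (k * l) by apply: mulr_ge0 => //; rewrite oppr_ge0 ltW.
have t1 : 0 <= t * k ^+ 2 by apply: mulr_ge0 => //; exact: ltW.
have e1 : t * k ^+ 2 = u * (k * l).
  by rewrite expr2 mulrA e; ring.
have te : t = 0.
  apply/eqP; have : t * k ^+ 2 == 0 by rewrite eq_le t1 andbT; lra.
  by rewrite mulf_eq0 (gt_eqF k2) orbF.
split=> //; apply/eqP; move: e; rewrite te mul0r => /esym/eqP.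
by rewrite mulf_eq0 (negbTE l0) orbF.
Qed.

Lemma orient_seg x y a c p (t : R) :
  p = (a.1 + t * (c.1 - a.1), a.2 + t * (c.2 - a.2)) ->
  orient x y p = (1 - t) * orient x y a + t * orient x y c.
Proof. by move=> ->; rewrite /orient /=; ring. Qed.

Lemma seg_start x y p (t : R) :
  p = (x.1 + t * (y.1 - x.1), x.2 + t * (y.2 - x.2)) -> t = 0 -> p = x.
Proof. by move=> -> ->; rewrite !mul0r !addr0 -surjective_pairing. Qed.

Lemma seg_end x y p (t : R) :
  p = (x.1 + t * (y.1 - x.1), x.2 + t * (y.2 - x.2)) -> 1 - t = 0 -> p = y.
Proof.
move=> -> /subr0_eq <-; rewrite !mul1r ![x.1 + _]addrC ![x.2 + _]addrC.
by rewrite !subrK -surjective_pairing.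
Qed.

(** The diagonal [a c] separates [b] from [d], so the path through [b] and the path through [d] can
    share only points of the line [a c], which are [a] and [c]. *)
Lemma quad_simple a b c d : orient a c b * orient a c d < 0 ->
  simple_polygon [:: a; b; c; d].
Proof.
move=> H.
have bN : orient a c b != 0 by apply: contraTneq H => ->; rewrite mul0r ltxx.
have dN : orient a c d != 0 by apply: contraTneq H => ->; rewrite mulr0 ltxx.
have ac : a <> c by move=> e; move: bN; rewrite e /orient; move/eqP; apply; ring.
(* The functional [orient a c] vanishes at [a] and [c], so along each edge it is a multiple of its
   value at [b] or at [d]. *)
have oab p (t : R) : p = (a.1 + t * (b.1 - a.1), a.2 + t * (b.2 - a.2)) ->
  orient a c p = t * orient a c b.
  by move/(orient_seg a c) => ->; rewrite orient_xyx; ring.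
have obc p (t : R) : p = (b.1 + t * (c.1 - b.1), b.2 + t * (c.2 - b.2)) ->
  orient a c p = (1 - t) * orient a c b.
  by move/(orient_seg a c) => ->; rewrite orient_xyy; ring.
have ocd p (t : R) : p = (c.1 + t * (d.1 - c.1), c.2 + t * (d.2 - c.2)) ->
  orient a c p = t * orient a c d.
  by move/(orient_seg a c) => ->; rewrite orient_xyy; ring.
have oda p (t : R) : p = (d.1 + t * (a.1 - d.1), d.2 + t * (a.2 - d.2)) ->
  orient a c p = (1 - t) * orient a c d.
  by move/(orient_seg a c) => ->; rewrite orient_xyx; ring.
split=> //; split.
  rewrite /= !inE !negb_or !andbT; apply/and3P; split; last 2 first.
  - apply/andP; split; [apply: contraNneq bN|apply: contraTneq H] => ->.
      by rewrite orient_xyy.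
    by rewrite -leNgt; exact: sqr_ge0.
  - by apply: contraNneq dN => <-; rewrite orient_xyy.
  apply/and3P; split; first by apply: contraNneq bN => <-; rewrite orient_xyx.
    exact/eqP.
  by apply: contraNneq dN => <-; rewrite orient_xyx.
move=> i j /andP[ij j4] p.
have {ij j4} : [\/ (i, j) = (0, 1), (i, j) = (0, 2), (i, j) = (0, 3) |
                 [\/ (i, j) = (1, 2), (i, j) = (1, 3) | (i, j) = (2, 3)]]%N.
  case: j ij j4 => [|[|[|[|j]]]] //; case: i => [|[|[|i]]] // _ _;
    do ?[by constructor|by constructor 4; constructor].
(* The pairs (0,1) and (2,3) meet at [b] and [d]. In the other four pairs the edges lie on opposite
   sides of [a c]: (0,3) meets at [a], (1,2) at [c], and (0,2), (1,3) would force [a = c]. *)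
case=> [[-> ->]|[-> ->]|[-> ->]|[[-> ->]|[-> ->]|[-> ->]]];
  rewrite /on_edge /vtx /=.
- by move=> h1 h2; left; split=> //; apply: (seg_meet _ h1 h2); rewrite orient_swapr oppr_eq0.
- move=> [t [/andP[t0 t1] et]] [u [/andP[u0 u1] eu]]; exfalso.
  have [t0' u0'] := opposite_coef_eq0 H t0 u0 (etrans (esym (oab _ _ et)) (ocd _ _ eu)).
  by apply: ac; rewrite -(seg_start et t0') (seg_start eu u0').
- move=> [t [/andP[t0 t1] et]] [u [/andP[u0 u1] eu]]; right; do 2 split=> //.
  have u1' : 0 <= 1 - u by rewrite subr_ge0.
  have [t0' _] := opposite_coef_eq0 H t0 u1' (etrans (esym (oab _ _ et)) (oda _ _ eu)).
  exact: seg_start et t0'.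
- move=> [t [/andP[t0 t1] et]] [u [/andP[u0 u1] eu]]; left; split=> //.
  have t1' : 0 <= 1 - t by rewrite subr_ge0.
  have [_ u0'] := opposite_coef_eq0 H t1' u0 (etrans (esym (obc _ _ et)) (ocd _ _ eu)).
  exact: seg_start eu u0'.
- move=> [t [/andP[t0 t1] et]] [u [/andP[u0 u1] eu]]; exfalso.
  have t1' : 0 <= 1 - t by rewrite subr_ge0.
  have u1' : 0 <= 1 - u by rewrite subr_ge0.
  have [t0' u0'] := opposite_coef_eq0 H t1' u1' (etrans (esym (obc _ _ et)) (oda _ _ eu)).
  by apply: ac; rewrite -(seg_end et t0') (seg_end eu u0').
- by move=> h1 h2; left; split=> //; apply: (seg_meet _ h1 h2); rewrite orient_rot.
Qed.

(** * Interior of a quadrilateral and a criterion for 4-holes *)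

Lemma vertex_boundary a b c d v : v \in [:: a; b; c; d] ->
  boundary [:: a; b; c; d] v.
Proof.
have st x y : on_seg x y x.
  by exists 0; rewrite lexx ler01; split=> //; rewrite !mul0r !addr0 -surjective_pairing.
rewrite !inE => /or4P[]/eqP->.
- by exists 0%N => //; exact: st.
- by exists 1%N => //; exact: st.
- by exists 2%N => //; exact: st.
- by exists 3%N => //; exact: st.
Qed.

Lemma boundary_in_tri a b c d p : boundary [:: a; b; c; d] p ->
  in_tri a b c p || in_tri a c d p.
Proof.
case=> i i4; have : [\/ i = 0, i = 1, i = 2 | i = 3]%N.
  by case: i i4 => [|[|[|[|i]]]] // _; constructor.
case=> ->; rewrite /on_edge /vtx /= => /in_tri_seg h.
- by rewrite h.
- by rewrite -in_tri_rot h.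
- by rewrite -(in_tri_rot a c d) h orbT.
- by rewrite -in_tri_rot -(in_tri_rot a c d) -(in_tri_rot c d a) h orbT.
Qed.

(* The union of the two triangles is star-shaped around [a], so the ray that
   leaves [a] through an outer point never meets it again. *)
Lemma outer_not_interior a b c d s :
  ~~ in_tri a b c s -> ~~ in_tri a c d s -> ~ interior_polygon [:: a; b; c; d] s.
Proof.
move=> h1 h2 [_ [M hM]].
have sa : s != a by apply: contraNneq h1 => ->; exact: in_tri1.
apply: (ray_unbounded sa); exists M => q hq; apply: hM.
have hs : (ray a s @` `[1, +oo[) s.
  exists 1; first by rewrite /= in_itv /= lexx.
  by rewrite /ray !mul1r ![a.1 + _]addrC ![a.2 + _]addrC !subrK -surjective_pairing.
apply: (connected_component_max hs) hq; last exact: connected_ray.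
move=> z [t /=]; rewrite in_itv /= andbT => t1 <- /boundary_in_tri /orP[].
  by move/(in_tri_ray t1); exact/negP.
by move/(in_tri_ray t1); exact/negP.
Qed.

Definition tri_empty (S : seq pt) a b c :=
  forall p, p \in S -> in_tri a b c p -> p \in [:: a; b; c].

(** A point of [S] in one of the two triangles is a vertex by emptiness, hence on the boundary; a
    point in neither is joined to infinity by a ray. *)
Lemma quad_hole (S : seq pt) a b c d :
  {subset [:: a; b; c; d] <= S} -> orient a c b * orient a c d < 0 ->
  tri_empty S a b c -> tri_empty S a c d -> is_k_hole 4 S [:: a; b; c; d].
Proof.
move=> sub H e1 e2; split=> //; split; first exact: quad_simple.
split; first exact/allP.
move=> s sS; have [st|] := boolP (in_tri a b c s); last first.
  move=> h1; have [st|] := boolP (in_tri a c d s); last exact: outer_not_interior.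
  case=> + _; apply; apply: vertex_boundary.
  by have := e2 _ sS st; rewrite !inE => /or3P[]/eqP->; rewrite eqxx ?orbT.
case=> + _; apply; apply: vertex_boundary.
by have := e1 _ sS st; rewrite !inE => /or3P[]/eqP->; rewrite eqxx ?orbT.
Qed.

(** * Angular order around a point *)

Lemma same_sign_trans (k l m : R) : 0 < k * l -> 0 < l * m -> 0 < k * m.
Proof.
move=> kl lm; have l0 : l != 0 by apply: contraTneq kl => ->; rewrite mulr0 ltxx.
have l2 : 0 < l ^+ 2 by rewrite exprn_even_gt0.
rewrite -(pmulr_rgt0 _ l2).
have -> : l ^+ 2 * (k * m) = (k * l) * (l * m) by ring.
exact: mulr_gt0.
Qed.

(* For [k = 1] or [-1]: minus the cotangent of the angle at [r] from [b] to [p],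
   which increases with that angle on the half-plane [0 < k * orient r b p]. *)
Definition slope_key k r b p : R :=
  - (((p.1 - r.1) * (b.1 - r.1) + (p.2 - r.2) * (b.2 - r.2)) / (k * orient r b p)).

Lemma slope_key_lt k r b p q : 0 < k * orient r b p -> 0 < k * orient r b q ->
  0 < k * orient r p q -> slope_key k r b p < slope_key k r b q.
Proof.
move=> hp hq hpq; rewrite /slope_key ltrN2.
rewrite ltr_pdivrMr // mulrAC ltr_pdivlMr //.
rewrite -subr_gt0; set d := (X in 0 < X).
(* After clearing denominators, the difference of the two cotangents is the squared length of [r b]
   times the signed area of [r p q]. *)
have -> : d = ((b.1 - r.1) ^+ 2 + (b.2 - r.2) ^+ 2) * (k * orient r p q).
  by rewrite /d /orient; ring.
apply: mulr_gt0 => //; rewrite lt_def addr_ge0 ?sqr_ge0 // andbT.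
rewrite paddr_eq0 ?sqr_ge0 // !sqrf_eq0; apply: contraTN hp => /andP[/eqP e1 /eqP e2].
by rewrite /orient e1 e2 !mul0r subrr mulr0 ltxx.
Qed.

End Geometry.

(** * Good pairs from two apices of different colours *)

Section Holes.
Variable R : realType.
Notation pt := (R * R)%type.
Variables (S : seq pt) (col : pt -> bool).
Hypothesis gp : general_position S.
Implicit Types a b c d p q r u v w x y z : pt.

Definition balanced P := is_k_hole 4 S P /\ count col P = 2%N.

Definition good_pair r b := exists P, [/\ balanced P, r \in P & b \in P].

Definition apex r b p := [/\ p \in S, p \notin [:: r; b] & tri_empty S r b p].

Lemma good_pairC r b : good_pair r b -> good_pair b r.
Proof. by case=> P [? ? ?]; exists P. Qed.

Lemma tri_emptyC a b c : tri_empty S a b c -> tri_empty S b a c.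
Proof. by move=> h p pS; rewrite in_tri_swap => /(h _ pS); rewrite !inE orbCA. Qed.

Lemma tri_empty_rot a b c : tri_empty S a b c -> tri_empty S b c a.
Proof.
by move=> h p pS; rewrite in_tri_rot => /(h _ pS); rewrite !inE => /or3P[]->; rewrite ?orbT.
Qed.

Lemma apexC r b p : apex r b p -> apex b r p.
Proof.
case=> pS pn e; split=> //; first by move: pn; rewrite !inE orbC.
exact: tri_emptyC.
Qed.

Lemma orient_neq0 a b c : a \in S -> b \in S -> c \in S ->
  a != b -> b != c -> a != c -> orient a b c != 0.
Proof. exact: (proj2 gp). Qed.

Lemma in_tri_strict a b c p : a \in S -> b \in S -> c \in S -> p \in S ->
  p \notin [:: a; b; c] -> a != b -> b != c -> a != c ->
  in_tri a b c p -> [/\ 0 < orient a b c * orient a b p,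
    0 < orient a b c * orient b c p & 0 < orient a b c * orient c a p].
Proof.
move=> aS bS cS pS; rewrite !inE !negb_or => /and3P[pa pb pc] ab bc ac.
case/and3P=> h1 h2 h3; have o := orient_neq0 aS bS cS ab bc ac.
split; rewrite lt_def ?h1 ?h2 ?h3 andbT mulf_neq0 //;
  by apply: orient_neq0 => //; rewrite eq_sym.
Qed.

Lemma in_tri_strict_pos a b c p : a \in S -> b \in S -> c \in S -> p \in S ->
  p \notin [:: a; b; c] -> a != b -> b != c -> a != c -> 0 < orient a b c ->
  in_tri a b c p -> [/\ 0 < orient a b p, 0 < orient b c p & 0 < orient c a p].
Proof.
move=> aS bS cS pS pn ab bc ac D0 h.
by have [] := in_tri_strict aS bS cS pS pn ab bc ac h; rewrite !pmulr_rgt0.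
Qed.

(** If the signs differed, one of [p], [q] would be seen under smaller angles from both [r] and [b],
    and would lie in the empty triangle of the other. *)
Lemma apex_dichotomy r b p q : r \in S -> b \in S -> r != b ->
  apex r b p -> apex r b q -> p != q ->
  0 < orient r b p -> 0 < orient r b q ->
  (0 < orient r p q) = (0 < orient b p q).
Proof.
move=> rS bS rb [pS pn pe] [qS qn qe] pq hp hq.
have [pr pb] : p != r /\ p != b by move: pn; rewrite !inE negb_or => /andP[].
have [qr qb] : q != r /\ q != b by move: qn; rewrite !inE negb_or => /andP[].
have o1 : orient r p q != 0 by rewrite orient_neq0 // 1?eq_sym // eq_sym.
have o2 : orient b p q != 0 by rewrite orient_neq0 // 1?eq_sym // eq_sym.
have np : ~~ in_tri r b q p.
  by apply/negP => /(qe _ pS); rewrite !inE (negbTE pr) (negbTE pb) (negbTE pq).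
have nq : ~~ in_tri r b p q.
  by apply/negP => /(pe _ qS); rewrite !inE (negbTE qr) (negbTE qb) eq_sym (negbTE pq).
move: np nq; rewrite !in_tri_pos // (ltW hp) (ltW hq) /=.
rewrite (orient_swapr b p q) -(orient_rot q r p) (orient_swap r p q).
rewrite !oppr_ge0 !negb_and -!ltNge.
have [] := ltrgtP (orient r p q) 0; have [] := ltrgtP (orient b p q) 0 => //;
  by move=> h1 h2; rewrite ?h1 ?h2 ?eqxx in o1 o2.
Qed.

Lemma balanced_quad a b c d : {subset [:: a; b; c; d] <= S} ->
  orient a c b * orient a c d < 0 ->
  tri_empty S a b c -> tri_empty S a c d ->
  count col [:: a; b; c; d] = 2%N -> balanced [:: a; b; c; d].
Proof. by move=> *; split=> //; exact: quad_hole. Qed.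

(** Among the bichromatic pairs of apices on this side, take one with [r p q] of least area. That
    triangle is then empty, and [r b p q] is the hole. *)
Lemma good_same_side r b p q : r \in S -> b \in S -> col r != col b ->
  apex r b p -> apex r b q -> 0 < orient r b p -> 0 < orient r b q ->
  col p != col q -> good_pair r b.
Proof.
move=> rS bS crb.
have rb : r != b by apply: contraNneq crb => ->.
pose K pq := [/\ apex r b pq.1, apex r b pq.2,
   [/\ 0 < orient r b pq.1, 0 < orient r b pq.2 & 0 < orient r pq.1 pq.2]
  & col pq.1 != col pq.2].
wlog h0 : p q / 0 < orient r p q.
  move=> W pA qA hp hq cpq.
  have pq : p != q by apply: contraNneq cpq => ->.
  have [h0|] := boolP (0 < orient r p q); first exact: (W p q).
  rewrite -leNgt => h0; apply: (W q p) => //; last by rewrite eq_sym.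
  have [[pS pn _] [qS qn _]] := (pA, qA).
  move: pn qn; rewrite !inE !negb_or => /andP[pr _] /andP[qr _].
  rewrite orient_swapr oppr_gt0 lt_def h0 andbT eq_sym.
  by rewrite orient_neq0 // eq_sym.
move=> pA qA hp hq cpq.
have : has (fun pq => `[< K pq >]) [seq (x, y) | x <- S, y <- S].
  apply/hasP; exists (p, q); last by apply/asboolP.
  by have [[pS _ _] [qS _ _]] := (pA, qA); apply/allpairsP; exists (p, q).
move=> {h0 pA qA hp hq cpq p q}/(seq_argmin (fun pq => orient r pq.1 pq.2)).
move=> [[p q] [_ /asboolP[/= pA qA [hp hq h0] cpq] Kmin]].
have pq : p != q by apply: contraNneq cpq => ->.
have {}Kmin p' q' : K (p', q') -> orient r p q <= orient r p' q'.
  move=> Kpq; apply: (Kmin (p', q')); last exact/asboolP.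
  by have [[pS _ _] [qS _ _] _ _] := Kpq; apply/allpairsP; exists (p', q').
have h1 : 0 < orient b p q by rewrite -(@apex_dichotomy r).
have [[pS pn pe] [qS qn qe]] := (pA, qA).
have [pr pb] : p != r /\ p != b by move: pn; rewrite !inE negb_or => /andP[].
have [qr qb] : q != r /\ q != b by move: qn; rewrite !inE negb_or => /andP[].
have [rp rq] : r != p /\ r != q by rewrite ![r == _]eq_sym.
have obpr : 0 < orient b p r by rewrite orient_rot.
have oqrb : 0 < orient q r b by rewrite -orient_rot.
have opqr : 0 < orient p q r by rewrite orient_rot.
have opqb : 0 < orient p q b by rewrite orient_rot.
have E : tri_empty S r p q.
  move=> w0 w0S w0t; apply: contraT => w0n.
  (* Among the points of [S] other than vertices in the triangle [r p q], take the one nearest to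
     the line [r b]; it turns out to be an apex. *)
  pose Q w := in_tri r p q w && (w \notin [:: r; p; q]).
  have : has Q S by apply/hasP; exists w0 => //; rewrite /Q w0t.
  case/(seq_argmin (orient r b)) => w [wS /andP[wt wn] wmin].
  have [s1 s2 s3] := in_tri_strict_pos rS pS qS wS wn rp pq rq h0 wt.
  have [wr wp wq] : [/\ w != r, w != p & w != q].
    by move: wn; rewrite !inE !negb_or => /and3P[].
  have wb : w != b.
    by apply: contraTneq s1 => ->; rewrite orient_swapr oppr_gt0 -leNgt ltW.
  have hw : 0 < orient r b w.
    have oN : orient r b w != 0 by apply: orient_neq0; rewrite // eq_sym.
    rewrite lt_def oN /=.
    by apply: (in_tri_halfpos h0 wt); rewrite ?orient_xyx ?lexx ?ltW.
  have hbpw : 0 < orient b p w.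
    have oN : orient b p w != 0 by apply: orient_neq0; rewrite // eq_sym.
    rewrite lt_def oN /=.
    by apply: (in_tri_halfpos h0 wt); rewrite ?orient_xyy ?lexx ?ltW.
  have wA : apex r b w.
    split=> //; first by rewrite !inE negb_or wr.
    move=> z zS zt; apply: contraT => zn.
    have [bw rw] : b != w /\ r != w by rewrite ![_ == w]eq_sym.
    have [z1 z2 z3] := in_tri_strict_pos rS bS wS zS zn rb bw rw hw zt.
    have [zr zb zw] : [/\ z != r, z != b & z != w].
      by move: zn; rewrite !inE !negb_or => /and3P[].
    have zp : z != p.
      by apply: contraTneq z2 => ->; rewrite orient_swapr oppr_gt0 -leNgt ltW.
    have zq : z != q.
      apply: contraTneq z3 => ->; rewrite orient_rot orient_rot orient_swap.
      by rewrite oppr_gt0 -leNgt ltW.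
    have g3 : 0 <= orient q r z.
      by apply: (in_tri_halfpos hw zt); rewrite ?orient_xyy ?lexx ?ltW.
    have g2 : 0 <= orient p q z.
      by apply: (in_tri_halfpos hw zt); rewrite ltW.
    have gb : 0 <= orient b p z.
      by apply: (in_tri_halfpos hw zt); rewrite ?orient_xyx ?lexx ?ltW.
    (* A point [z] of the triangle [r b w] lies either in [r p q], nearer to [r b] than [w], or in
       the empty triangle [r b p]. *)
    have [g1|g1] := leP 0 (orient r p z).
      have zQ : Q z.
        by rewrite /Q in_tri_pos // g1 g2 g3 !inE !negb_or zr zp zq.
      have := wmin z zS zQ; have := orient_split z r b w; lra.
    have : in_tri r b p z.
      by rewrite in_tri_pos // (ltW z1) gb orient_swap oppr_ge0 ltW.
    by move/(pe _ zS); rewrite !inE (negbTE zr) (negbTE zb) (negbTE zp).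
  (* The colour of [w] differs from that of [p] or of [q], so [(p, w)] or [(w, q)] is a competing
     pair of smaller area. *)
  have sp := orient_split w r p q.
  have s3' : orient q r w = orient r w q by rewrite -orient_rot.
  have [cwq|cwq] := boolP (col w == col q); last first.
    have : K (w, q) by split=> //; split=> //=; rewrite -s3'.
    by move/Kmin; lra.
  have : K (p, w) by split=> //=; rewrite (eqP cwq).
  by move/Kmin; lra.
exists [:: r; b; p; q]; split; rewrite ?inE ?eqxx ?orbT //.
apply: balanced_quad => //.
- by move=> v; rewrite !inE => /or4P[]/eqP->.
- by rewrite (orient_swapr r b p) mulNr oppr_lt0 mulr_gt0.
- by move: crb cpq => /=; case: (col r); case: (col b); case: (col p); case: (col q).
Qed.

(** Apices on opposite sides of [r b] give the hole [r p b q] with diagonal [r b]. On a common side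
    [good_same_side] applies, after exchanging [r] and [b] if that side is the negative one. *)
Lemma good_of_two_apices r b p q : r \in S -> b \in S -> col r != col b ->
  apex r b p -> apex r b q -> col p != col q -> good_pair r b.
Proof.
move=> rS bS crb pA qA cpq.
have rb : r != b by apply: contraNneq crb => ->.
have [[pS pn pe] [qS qn qe]] := (pA, qA).
have [pr pb] : p != r /\ p != b by move: pn; rewrite !inE negb_or => /andP[].
have [qr qb] : q != r /\ q != b by move: qn; rewrite !inE negb_or => /andP[].
have op : orient r b p != 0 by rewrite orient_neq0 // eq_sym.
have oq : orient r b q != 0 by rewrite orient_neq0 // eq_sym.
have [H|H] := ltP (orient r b p * orient r b q) 0.
  exists [:: r; p; b; q]; split; rewrite ?inE ?eqxx ?orbT //.
  apply: balanced_quad => //.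
  - by move=> v; rewrite !inE => /or4P[]/eqP->.
  - by apply: tri_emptyC; do 2 apply: tri_empty_rot.
  - by move: crb cpq => /=; case: (col r); case: (col b); case: (col p); case: (col q).
have {}H : 0 < orient r b p * orient r b q by rewrite lt_def H mulf_neq0.
have [hp|hp] := ltP 0 (orient r b p).
  by apply: (@good_same_side r b p q) => //; rewrite -(pmulr_rgt0 _ hp).
have {}hp : orient r b p < 0 by rewrite lt_def eq_sym op.
apply/good_pairC/(@good_same_side b r p q) => //; rewrite 1?eq_sym //; try exact: apexC.
  by rewrite orient_swap oppr_gt0.
by rewrite orient_swap oppr_gt0 -(nmulr_rgt0 _ hp).
Qed.

(** * Triangles with few inner points *)

(* The point [x] cuts the triangle into three, of which [y] meets at most one;
   the other two form the quadrilateral. *)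
Lemma inner_pair_hole_pos u v w x y :
  {subset [:: u; v; w; x; y] <= S} -> uniq [:: u; v; w; x] ->
  y \notin [:: u; v; w] -> 0 < orient u v w ->
  in_tri u v w x -> in_tri u v w y ->
  (forall p, p \in S -> in_tri u v w p -> p \in [:: u; v; w; x; y]) ->
  exists P, is_k_hole 4 S P /\ perm_eq P [:: u; v; w; x].
Proof.
move=> sub /=; rewrite !inE !negb_or andbT.
case/and3P=> /and3P[uv uw ux] /andP[vw vx] wx /and3P[yu yv yw] D0 xt yt cover.
have [uS vS wS xS yS] : [/\ u \in S, v \in S, w \in S, x \in S & y \in S].
  by split; apply: sub; rewrite !inE eqxx ?orbT.
have xn : x \notin [:: u; v; w] by rewrite !inE !negb_or ![x == _]eq_sym ux vx.
have [x1 x2 x3] := in_tri_strict_pos uS vS wS xS xn uv vw uw D0 xt.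
(* The only candidates in the triangle [a b x] are the five listed points; [c] is excluded because
   it lies beyond the line [b x]. *)
have part a b c : 0 < orient a b x -> in_tri u v w a -> in_tri u v w b ->
    [:: a; b; c] \in [:: [:: u; v; w]; [:: v; w; u]; [:: w; u; v]] ->
    0 < orient b c x -> (y == x) || ~~ in_tri a b x y -> tri_empty S a b x.
  move=> D1 at_ bt abc ox hy p pS pt0.
  have pt1 : in_tri u v w p.
    by apply: in_tri_trans at_ bt xt pt0; rewrite gt_eqF.
  have pc : p != c.
    apply: contraTneq pt0 => ->.
    by rewrite in_tri_pos // (orient_swapr b c x) oppr_ge0 [_ <= 0]leNgt ox /= andbF.
  have py : (p == x) || (p != y).
    have [py|] := eqVneq p y; last by rewrite orbT.
    by move: hy; rewrite -py pt0 orbF => ->.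
  have := cover p pS pt1.
  by move: abc pc py; rewrite !inE => /or3P[]/eqP[-> -> ->];
    case: (p == u); case: (p == v); case: (p == w); case: (p == x); case: (p == y).
have side a b : a \in S -> b \in S -> a != b -> a != x -> b != x -> y != a ->
    y != b -> 0 < orient a b x -> y != x -> in_tri a b x y ->
    0 < orient b x y /\ 0 < orient x a y.
  move=> aS bS ab ax bx ya yb D1 yx yt1.
  have yn : y \notin [:: a; b; x] by rewrite !inE !negb_or ya yb.
  by have [_ ? ?] := in_tri_strict_pos aS bS xS yS yn ab bx ax D1 yt1.
have wu : w != u by rewrite eq_sym.
have [tu tv tw] : [/\ in_tri u v w u, in_tri u v w v & in_tri u v w w].
  by rewrite in_tri1 in_tri2 in_tri3.
have E1 : (y == x) || ~~ in_tri u v x y -> tri_empty S u v x.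
  by apply: (part u v w) => //; rewrite !inE eqxx.
have E2 : (y == x) || ~~ in_tri v w x y -> tri_empty S v w x.
  by apply: (part v w u) => //; rewrite !inE eqxx orbT.
have E3 : (y == x) || ~~ in_tri w u x y -> tri_empty S w u x.
  by apply: (part w u v) => //; rewrite !inE eqxx !orbT.
have hole a b c : {subset [:: a; b; x; c] <= S} -> 0 < orient a b x ->
    0 < orient c a x -> tri_empty S a b x -> tri_empty S c a x ->
    is_k_hole 4 S [:: a; b; x; c].
  move=> sb o1 o2 e1 e2; apply: quad_hole => //; last exact: tri_empty_rot.
  by rewrite (orient_swapr a b x) (orient_rot c a x) mulNr oppr_lt0 mulr_gt0.
(* Two of the small triangles share an edge from [x] and lie on opposite sides of it, so [y] is not
   in both. *)
have disj a b c : (0 < orient b x y /\ 0 < orient x a y) ->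
   (0 < orient c x y /\ 0 < orient x b y) -> False.
  by move=> [h1 _] [_]; rewrite (orient_swap b x) oppr_gt0 ltNge (ltW h1).
have [pm1 pm2 pm3 _] := perm_quad u v w x.
(* The case [y = x] is that of a single inner point: all three small triangles are empty. *)
have [yx|yx] := eqVneq y x.
  exists [:: u; v; x; w]; split=> //.
  apply: hole => //; [|by apply: E1; rewrite yx eqxx|by apply: E3; rewrite yx eqxx].
  by move=> p; rewrite !inE => /or4P[]/eqP->.
have S1 := side u v uS vS uv ux vx yu yv x1 yx.
have S2 := side v w vS wS vw vx wx yv yw x2 yx.
have S3 := side w u wS uS wu wx ux yw yu x3 yx.
rewrite (negbTE yx) /= in E1 E2 E3.
have [b1|/E1{}E1] := boolP (in_tri u v x y).
  have {}E2 : tri_empty S v w x.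
    by apply: E2; apply/negP => /S2; apply: disj (S1 b1).
  have {}E3 : tri_empty S w u x.
    by apply: E3; apply/negP => /S3 S3'; apply: disj S3' (S1 b1).
  exists [:: w; u; x; v]; split=> //.
  by apply: hole => // p; rewrite !inE => /or4P[]/eqP->.
have [b2|/E2{}E2] := boolP (in_tri v w x y).
  have {}E3 : tri_empty S w u x.
    by apply: E3; apply/negP => /S3; apply: disj (S2 b2).
  exists [:: u; v; x; w]; split=> //.
  by apply: hole => // p; rewrite !inE => /or4P[]/eqP->.
exists [:: v; w; x; u]; split=> //.
by apply: hole => // p; rewrite !inE => /or4P[]/eqP->.
Qed.

(** The hole has the vertex [x] besides those of the triangle, so the caller can balance it by the
    colour of [x]. A clockwise triangle is handled by exchanging [u] and [v]. *)
Lemma inner_pair_hole u v w x y :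
  {subset [:: u; v; w; x; y] <= S} -> uniq [:: u; v; w; x] ->
  y \notin [:: u; v; w] -> in_tri u v w x -> in_tri u v w y ->
  (forall p, p \in S -> in_tri u v w p -> p \in [:: u; v; w; x; y]) ->
  exists P, is_k_hole 4 S P /\ perm_eq P [:: u; v; w; x].
Proof.
move=> sub uq yn xt yt cover.
have D0 : orient u v w != 0.
  move: uq; rewrite /= !inE !negb_or andbT => /and3P[/and3P[uv uw _] /andP[vw _] _].
  by apply: orient_neq0 => //; apply: sub; rewrite !inE eqxx ?orbT.
have [D1|D1] := ltP 0 (orient u v w); first exact: (@inner_pair_hole_pos u v w x y).
have [_ _ _ pm] := perm_quad u v w x.
have [|||||||P [hP pP]] := @inner_pair_hole_pos v u w x y; last 1 first.
- by exists P; split=> //; exact: perm_trans pP pm.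
- by move=> p pv; apply: sub; move: pv; rewrite !inE orbCA.
- by rewrite (perm_uniq pm).
- by move: yn; rewrite !inE orbCA.
- by rewrite orient_swap oppr_gt0 lt_def eq_sym D0.
- by rewrite in_tri_swap.
- by rewrite in_tri_swap.
- by move=> p pS; rewrite in_tri_swap => /(cover p pS); rewrite !inE orbCA.
Qed.

(** By [orient_split] the area of [r b w] exceeds that of [r b p] by two other subareas, of which
    [b w p] is positive in general position. *)
Lemma orient_height r b w p : r \in S -> b \in S -> w \in S -> p \in S ->
  uniq [:: r; b; w] -> p \notin [:: r; b; w] -> in_tri r b w p ->
  `|orient r b p| < `|orient r b w|.
Proof.
move=> rS bS wS pS; rewrite /= !inE !negb_or andbT => /andP[/andP[rb rw] bw].
case/and3P=> pr pb pw /and3P[h1 h2 h3].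
have o1 : orient r b w != 0 by apply: orient_neq0.
have o2 : orient b w p != 0 by apply: orient_neq0; rewrite // eq_sym.
have o3 : 0 < orient r b w ^+ 2 by rewrite exprn_even_gt0.
have h2' : 0 < orient r b w * orient b w p by rewrite lt_def h2 mulf_neq0.
rewrite -(ltr_pM2l (_ : 0 < `|orient r b w|)) ?normr_gt0 //.
rewrite -!normrM !ger0_norm //; last by rewrite -expr2 ltW.
have -> : orient r b w * orient r b w = orient r b w * orient r b p
    + orient r b w * orient b w p + orient r b w * orient w r p.
  by rewrite -!mulrDr -orient_split.
by rewrite -addrA ltrDl ltr_pwDl.
Qed.

Lemma three_inner r b b' : r \in S -> b \in S -> b' \in S ->
  col r != col b -> ~ good_pair r b ->
  (forall p, apex r b p -> col p = col r) -> b' != b -> col b' = col b ->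
  (3 <= count (fun x => [&& col x == col r, in_tri r b b' x & x \notin [:: r; b; b']]) S)%N.
Proof.
move=> rS bS b'S crb bad apx b'b cb'.
pose Q z := [&& col z == col b, z != b & in_tri r b b' z].
have rb : r != b by apply: contraNneq crb => ->.
have neqr z : col z = col b -> z != r by move=> cz; apply: contraNneq crb => <-; rewrite cz.
have : has Q S by apply/hasP; exists b' => //; rewrite /Q cb' eqxx b'b in_tri3.
(* The shrinking step: [c] is the point of the colour of [b] nearest to the line [r b], so by
   [orient_height] none of that colour is left inside [r b c]. *)
case/(seq_argmin (fun z => `|orient r b z|)) => c [cS /and3P[/eqP cc cb ct] cmin].
have cr := neqr _ cc.
have rbc0 : orient r b c != 0 by apply: orient_neq0; rewrite // eq_sym.
have sub z : in_tri r b c z -> in_tri r b b' z.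
  exact: in_tri_trans rbc0 (in_tri1 _ _ _) (in_tri2 _ _ _) ct.
pose In z := in_tri r b c z && (z \notin [:: r; b; c]).
have ured z : z \in S -> In z -> col z = col r.
  move=> zS /andP[zt zn]; apply/eqP; apply: contraT => czr.
  have zc : col z = col b by move: czr crb; case: (col z); case: (col r); case: (col b).
  have zb : z != b by move: zn; rewrite !inE !negb_or => /and3P[].
  have /(cmin _ zS) : Q z by rewrite /Q zc eqxx zb sub.
  rewrite leNgt orient_height //=.
  by rewrite !inE !negb_or rb ![_ == c]eq_sym cr cb.
have cnt : (count In S <= count (fun x =>
    [&& col x == col r, in_tri r b b' x & x \notin [:: r; b; b']]) S)%N.
  rewrite -!size_filter; apply: uniq_leq_size; first exact: filter_uniq (proj1 gp).
  move=> z; rewrite !mem_filter => /andP[zI zS]; rewrite zS andbT ured // eqxx /=.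
  have [zt zn] := andP zI; rewrite sub //=.
  move: zn; rewrite !inE !negb_or => /and3P[-> -> zc] /=.
  apply: contraNneq crb => zb'; rewrite -(ured _ zS zI) zb' cb'; exact: eqxx.
apply: leq_trans cnt; rewrite leqNgt; apply/negP; rewrite -size_filter ltnS => sz.
have memI z : (z \in [seq x <- S | In x]) = In z && (z \in S) by rewrite mem_filter.
(* With no inner point, [c] would be an apex of the colour of [b], against the hypothesis on
   apices. *)
case: [seq x <- S | In x] memI sz => [|x s] memI sz.
  have cA : apex r b c.
    split=> //; first by rewrite !inE negb_or cr.
    move=> p pS pt; have := memI p; rewrite pS /In pt andbT /= in_nil.
    by move/esym/negbFE.
  by move: crb; rewrite -(apx _ cA) cc eqxx.
(* For a single inner point the witness is [y = x]. *)
have [y [ys cov]] : exists y, y \in x :: s /\ forall z, z \in x :: s -> z = x \/ z = y.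
  case: s sz {memI} => [|y [|//]] _.
    by exists x; rewrite mem_head; split=> // z; rewrite inE => /eqP; left.
  exists y; rewrite !inE eqxx orbT; split=> // z.
  by rewrite !inE => /orP[]/eqP; [left|right].
have xs : x \in x :: s by exact: mem_head.
have /andP[/andP[xt xn] xS] : In x && (x \in S) by rewrite -memI.
have /andP[/andP[yt yn] yS] : In y && (y \in S) by rewrite -memI.
have [||||||P [hP pP]] := @inner_pair_hole r b c x y => //.
- by move=> z; rewrite !inE => /or4P[||/eqP->//|/orP[]]/eqP->.
- move: xn; rewrite /= !inE !negb_or => /and3P[xr xb xc].
  rewrite rb (eq_sym r c) (eq_sym b c) (eq_sym r x) (eq_sym b x) (eq_sym c x).
  by rewrite cr cb xr xb xc.
- move=> p pS pt; have [pv|pn] := boolP (p \in [:: r; b; c]).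
    by move: pv; rewrite !inE => /or3P[]->; rewrite ?orbT.
  have : p \in x :: s by rewrite memI /In pt pn.
  by move/cov=> [->|->]; rewrite !inE eqxx ?orbT.
apply: bad; exists P; rewrite !(perm_mem pP) !inE !eqxx orbT; split=> //; split=> //.
rewrite (permP pP) /= cc (ured x) // ?/In ?xt //.
by move: crb; case: (col r); case: (col b).
Qed.

(** * Disjoint sectors around a point *)

Lemma half_fan k r b0 (L X : seq pt) : r \in S -> b0 \in S -> r != b0 ->
  {subset L <= S} -> {subset X <= S} -> uniq L -> b0 \notin X ->
  {in L, forall p, 0 < k * orient r b0 p} ->
  {in b0 :: L &, forall p q, q != p ->
    (3 <= count (fun x => in_tri r p q x && (x \notin [:: r; p; q])) X)%N} ->
  (3 * size L <= count (fun x => (0 < k * orient r b0 x)%R) X)%N.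
Proof.
move=> rS b0S rb0 LS XS uL b0X hL gap.
(* Sorting by [key] is sorting by angle from the ray [r b0]; the triangles between consecutive rays
   fall into disjoint sectors, each with three points of [X]. *)
pose key := slope_key k r b0.
have neq p : p \in L -> r != p /\ b0 != p.
  move=> /hL hp; split; apply: contraTneq hp => <-.
    by rewrite orient_xyx mulr0 ltxx.
  by rewrite orient_xyy mulr0 ltxx.
have k0 p : p \in L -> k != 0 by move=> /hL; apply: contraTneq => ->; rewrite mul0r ltxx.
have keyP p q : p \in L -> q \in L -> q != p ->
    (key p < key q) = (0 < k * orient r p q).
  move=> pL qL qp; have [rp _] := neq p pL; have [rq _] := neq q qL.
  apply/idP/idP; last by apply: slope_key_lt; exact: hL.
  rewrite ltNge; apply: contraNT; rewrite -leNgt => h.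
  have o : orient r p q != 0.
    by apply: orient_neq0 => //; [exact: LS|exact: LS|rewrite eq_sym].
  apply/ltW/slope_key_lt; [exact: hL|exact: hL|].
  by rewrite orient_swapr mulrN oppr_gt0 lt_def h eq_sym andbT mulf_neq0 // (k0 p).
have keyinj : {in L &, injective key}.
  move=> p q pL qL e; apply/eqP; apply: contraT => pq.
  have [rp _] := neq p pL; have [rq _] := neq q qL.
  have o : orient r p q != 0 by apply: orient_neq0 => //; exact: LS.
  have qp : q != p by rewrite eq_sym.
  have : k * orient r p q != 0 by rewrite mulf_neq0 // (k0 p).
  rewrite neq_lt -keyP // e ltxx orbF.
  by rewrite -oppr_gt0 -mulrN -orient_swapr -keyP // e ltxx.
rewrite -(size_map key L) -size_filter -(size_map key).
apply: three_per_gap; first by rewrite map_inj_in_uniq.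
(* The key of [b0] would divide by zero, so the sector from [b0] to [p] becomes the interval
   unbounded below [key p]. *)
- move=> _ /mapP[p pL ->]; rewrite count_map count_filter.
  have [rp b0p] := neq p pL.
  have pb0 : p != b0 by rewrite eq_sym.
  apply: leq_trans (gap b0 p (mem_head _ _) (mem_cons_tail pL) pb0) _.
  apply: sub_in_count => x /XS xS /andP[xt xn] /=.
  have [h1 h2 h3] := in_tri_strict rS b0S (LS _ pL) xS xn rb0 b0p rp xt.
  have hx := same_sign_trans (hL p pL) h1; rewrite hx andbT.
  apply: slope_key_lt => //; first exact: hL.
  by apply: same_sign_trans (hL p pL) _; rewrite (orient_rot p r x).
- move=> _ _ /mapP[p pL ->] /mapP[q qL ->] kpq; rewrite count_map count_filter.
  have qp : q != p by apply: contraTneq kpq => ->; rewrite ltxx.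
  have [rp _] := neq p pL; have [rq _] := neq q qL.
  have pq : p != q by rewrite eq_sym.
  apply: leq_trans (gap p q (mem_cons_tail pL) (mem_cons_tail qL) qp) _.
  apply: sub_in_count => x xX /andP[xt xn] /=; have xS := XS x xX.
  have [h1 h2 h3] := in_tri_strict rS (LS _ pL) (LS _ qL) xS xn rp pq rq xt.
  have kD : 0 < k * orient r p q by rewrite -keyP.
  have o : orient r p q != 0 by apply: contraTneq kD => ->; rewrite mulr0 ltxx.
  (* Convexity gives the closed half-plane; general position removes its border, as [x] is neither
     [r] nor [b0]. *)
  have hx : 0 < k * orient r b0 x.
    rewrite lt_def; apply/andP; split.
      rewrite mulf_neq0 ?(k0 p) //; apply: orient_neq0 => //.
        by apply: contraNneq b0X => ->.
      by move: xn; rewrite !inE !negb_or eq_sym => /and3P[].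
    apply: (in_tri_half o xt); first by rewrite orient_xyx mulr0.
      by rewrite ltW // hL.
    by rewrite ltW // hL.
  rewrite hx andbT; apply/andP; split; apply: slope_key_lt => //; try exact: hL.
    exact: same_sign_trans kD h1.
  by apply: same_sign_trans kD _; rewrite (orient_rot q r x).
Qed.

(** The line through [r] and one point [b0] of [F] leaves all other points of [F] in two open
    half-planes, each treated by [half_fan]. The summand 3 pays for [b0] itself. *)
Lemma fan_bound r (F X : seq pt) : r \in S -> {subset F <= S} -> {subset X <= S} ->
  uniq F -> r \notin F -> {in F, forall b, b \notin X} ->
  {in F &, forall b b', b' != b ->
    (3 <= count (fun x => in_tri r b b' x && (x \notin [:: r; b; b'])) X)%N} ->
  (3 * size F <= size X + 3)%N.
Proof.
move=> rS; case: F => [|b0 F] FS XS; first by rewrite muln0.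
rewrite inE negb_or => /andP[b0F uF] /andP[rb0 rF] FX gap.
have b0S : b0 \in S by apply: FS; exact: mem_head.
have half (k : R) : k != 0 ->
   (3 * count (fun x => (0 < k * orient r b0 x)%R) F <=
    count (fun x => (0 < k * orient r b0 x)%R) X)%N.
  move=> k0; rewrite -size_filter; apply: half_fan => //.
  - by move=> p; rewrite mem_filter => /andP[_ pF]; apply/FS/mem_cons_tail.
  - exact: filter_uniq.
  - by apply: FX; exact: mem_head.
  - by move=> p; rewrite mem_filter => /andP[].
  - have sF p : p \in b0 :: [seq x <- F | 0 < k * orient r b0 x] -> p \in b0 :: F.
      by rewrite !inE mem_filter => /predU1P[->|/andP[_ ->]]; rewrite ?eqxx ?orbT.
    by move=> p q /sF pF /sF qF; exact: gap.
have hp := half 1 (oner_neq0 _).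
have hn : (3 * count (fun x => (0 < -1 * orient r b0 x)%R) F <=
    count (fun x => (0 < -1 * orient r b0 x)%R) X)%N.
  by apply: half; rewrite oppr_eq0 oner_neq0.
have sF : (size F <= count (fun x => (0 < 1 * orient r b0 x)%R) F +
     count (fun x => (0 < -1 * orient r b0 x)%R) F)%N.
  rewrite -count_predUI -(count_predT F).
  apply: leq_trans (leq_addr _ _); apply: sub_in_count => p pF _ /=.
  have : orient r b0 p != 0.
    apply: orient_neq0 => //; first by apply/FS/mem_cons_tail.
      by apply: contraNneq b0F => ->.
    by apply: contraNneq rF => ->.
  by rewrite mul1r mulN1r oppr_gt0 neq_lt orbC.
have sX : (count (fun x => (0 < 1 * orient r b0 x)%R) X +
     count (fun x => (0 < -1 * orient r b0 x)%R) X <= size X)%N.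
  rewrite -(count_predT X); apply: count_disjoint => // x.
  by rewrite mul1r mulN1r oppr_gt0; case: ltgtP.
rewrite /= mulnS addnC leq_add2r; apply: leq_trans sX.
apply: leq_trans (leq_add hp hn); by rewrite -mulnDr leq_mul2l sF orbT.
Qed.

(** * Bad pairs, charged to an endpoint whose colour all apices share *)

Definition bad_for r : seq pt :=
  [seq b <- S | (col r != col b) &&
    `[< ~ good_pair r b /\ forall p, apex r b p -> col p = col r >]].

Lemma bad_for_bound r : r \in S ->
  (3 * size (bad_for r) <= count (fun x => col x == col r) S + 2)%N.
Proof.
move=> rS; have uS : uniq S by exact: (proj1 gp).
pose C := [seq x <- S | col x == col r].
have rC : r \in C by rewrite mem_filter eqxx.
(* The fan is filled by the colour class of [r] without [r], one point fewer, which turns the 3 of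
   [fan_bound] into 2. *)
have -> : count (fun x => col x == col r) S = (size (rem r C)).+1.
  rewrite size_rem // -size_filter -/C prednK //.
  by case: (C) rC.
rewrite addSnnS; apply: (fan_bound rS) => //.
- by move=> b; rewrite mem_filter => /andP[].
- by move=> x /mem_rem; rewrite mem_filter => /andP[].
- exact: filter_uniq.
- by rewrite mem_filter eqxx.
- move=> b; rewrite mem_filter => /andP[/andP[crb _] _].
  apply: contraNN crb => /mem_rem; rewrite mem_filter eq_sym.
  by case/andP.
move=> b b'; rewrite !mem_filter.
move=> /andP[/andP[crb /asboolP[bad apx]] bS] /andP[/andP[crb' _] b'S] b'b.
have cbb' : col b' = col b.
  by move: crb crb'; case: (col r); case: (col b); case: (col b').
apply: leq_trans (three_inner rS bS b'S crb bad apx b'b cbb') _.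
rewrite rem_filter ?filter_uniq // !count_filter; apply: sub_count => x /=.
case/and3P=> -> -> xn; rewrite xn andbT /=.
by move: xn; rewrite inE negb_or => /andP[].
Qed.

(** Otherwise one apex differs in colour from [r] and another from [b]; with two colours these
    apices differ from each other and make the pair good. *)
Lemma bad_for_cover r b : r \in S -> b \in S -> col r != col b ->
  ~ good_pair r b -> (b \in bad_for r) || (r \in bad_for b).
Proof.
move=> rS bS crb bad; rewrite !mem_filter rS bS !andbT crb [col b == _]eq_sym crb /=.
have [//|/asboolPn nr] := boolP `[< _ /\ _ >] => /=.
apply/asboolP; split=> [/good_pairC//|q qA].
apply: contrapT => cq; apply: nr; split=> // p pA.
apply: contrapT => cp; apply: bad.
apply: (good_of_two_apices rS bS crb pA (apexC qA)).
by move: cp cq crb; case: (col p); case: (col q); case: (col r); case: (col b).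
Qed.

(** Holes are collected greedily along [s]. A hole equal to an earlier one up to [same_polygon] is
    skipped: the earlier one has the same vertices and covers the pair too. *)
Lemma hole_family (s : seq (pt * pt)) : exists H : seq (seq pt),
  [/\ forall P, P \in H -> balanced P,
      forall i j, (i < j < size H)%N -> ~ same_polygon (nth [::] H i) (nth [::] H j)
    & forall e, e \in s -> good_pair e.1 e.2 ->
        exists2 P, P \in H & (e.1 \in P) && (e.2 \in P)].
Proof.
elim: s => [|e s [H [Hb Hd Hc]]]; first by exists [::]; split=> // i j; rewrite andbF.
have [[P [bP P1 P2]]|ng] := EM (good_pair e.1 e.2); last first.
  exists H; split=> // e'; rewrite inE => /predU1P[->|/Hc]//.
have [[Q QH sPQ]|nQ] := EM (exists2 Q, Q \in H & same_polygon P Q).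
  exists H; split=> // e'; rewrite inE => /predU1P[->|/Hc//] _.
  have PQ : P =i Q.
    by case: sPQ => k [->|->] x; rewrite mem_rot ?mem_rev.
  by exists Q => //; rewrite -!PQ P1.
exists (P :: H); split.
- by move=> Q; rewrite inE => /predU1P[->|/Hb].
- move=> [|i] [|j] //= ij; last exact: Hd.
  by move=> sP; apply: nQ; exists (nth [::] H j) => //; exact: mem_nth.
- move=> e'; rewrite inE => /predU1P[->|/Hc h] g.
    by exists P; rewrite ?mem_head ?P1.
  by have [Q QH eQ] := h g; exists Q => //; rewrite inE QH orbT.
Qed.
End Holes.

(** * Double counting of the bichromatic pairs *)

Theorem theorem1 (R : realType) (n : nat) (Rd Bl : seq (R * R)%type) :
  size Rd = n -> size Bl = n -> uniq Rd -> uniq Bl ->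
  (forall p, p \in Rd -> p \notin Bl) ->
  general_position (Rd ++ Bl) ->
  exists H : seq (seq (R * R)%type),
    (forall P, P \in H -> balanced_4hole Rd Bl P) /\
    (forall i j, (i < j < size H)%N -> ~ same_polygon (nth [::] H i) (nth [::] H j)) /\
    ((n ^ 2)%:R - (4 * n)%:R) / 12%:R <= (size H)%:R :> R.
Proof.
move=> sR sB uR uB dis gp.
pose S := Rd ++ Bl; pose col (v : R * R) := v \in Rd.
have colB v : v \in Bl -> col v = false.
  by move=> vB; apply: contraTF vB; exact: dis.
have [H [Hb Hd Hc]] := @hole_family R S col [seq (r, b) | r <- Rd, b <- Bl].
have hole P : P \in H -> balanced_4hole Rd Bl P.
  move=> /Hb[kP cP]; split=> //; split=> //.
  have [sP [_ [/allP subP _]]] := kP.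
  have -> : count (fun v => v \in Bl) P = count (predC col) P.
    apply: eq_in_count => v /subP; rewrite mem_cat /= /col => /orP[vR|vB].
      by rewrite vR (negbTE (dis _ vR)).
    by rewrite vB; have := colB _ vB; rewrite /col => ->.
  by have := count_predC col P; rewrite sP cP => /(@addnI 2 _ 2).
exists H; split=> //; split=> //.
have RS r : r \in Rd -> r \in S by rewrite mem_cat => ->.
have BS b : b \in Bl -> b \in S by rewrite mem_cat orbC => ->.
have cntR : count col Rd = n by rewrite -sR; apply/eqP; rewrite -all_count; apply/allP.
have cntB : count col Bl = 0%N.
  by apply/eqP; rewrite -leqn0 leqNgt -has_count; apply/hasPn => v /colB ->.
have bR r : r \in Rd -> (3 * size (bad_for S col r) <= n + 2)%N.
  move=> rR; apply: leq_trans (bad_for_bound col gp (RS _ rR)) _.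
  rewrite leq_add2r (_ : col r = true) //.
  by rewrite (eq_count (a2 := col)) ?count_cat ?cntR ?cntB ?addn0 // => v; case: (col v).
have bB b : b \in Bl -> (3 * size (bad_for S col b) <= n + 2)%N.
  move=> bBl; apply: leq_trans (bad_for_bound col gp (BS _ bBl)) _.
  rewrite leq_add2r colB // (eq_count (a2 := predC col)); last by move=> v /=; case: (col v).
  rewrite -(leq_add2l (count col S)) count_predC count_cat cntR cntB.
  by rewrite size_cat sR sB addn0.
pose F r := bad_for S col r.
(* Each of the [n * n] pairs is counted at least once: as bad for [r], as bad for [b], or through a
   hole of [H] with both vertices. *)
have key : (n * n <= \sum_(r <- Rd) \sum_(b <- Bl)
    ((b \in F r) + (r \in F b) + \sum_(P <- H) (r \in P) * (b \in P)))%N.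
  have -> : (n * n = \sum_(r <- Rd) \sum_(b <- Bl) 1)%N.
    by rewrite sum1_size sB -[X in (X * _)%N]sR -sum1_size big_distrl /=;
       apply: eq_bigr => r _; rewrite mul1n.
  rewrite big_seq [X in (_ <= X)%N]big_seq; apply: leq_sum => r rR.
  rewrite big_seq [X in (_ <= X)%N]big_seq; apply: leq_sum => b bBl.
  have crb : col r != col b by rewrite (colB b bBl) /col rR.
  have [g|ng] := EM (good_pair S col r b).
    have rbs : (r, b) \in [seq (r, b) | r <- Rd, b <- Bl].
      by apply/allpairsP; exists (r, b).
    have [P PH /= /andP[rP bP]] := Hc _ rbs g.
    by rewrite (big_rem P PH) /= rP bP !addn_gt0 orbT.
  have := bad_for_cover gp (RS r rR) (BS b bBl) crb ng.
  by rewrite -/(F r) -/(F b); case: (b \in F r); case: (r \in F b).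
have sum_leq (s : seq (R * R)) (f : R * R -> nat) m :
    (forall x, x \in s -> f x <= m)%N -> (\sum_(x <- s) f x <= size s * m)%N.
  move=> h; rewrite -sum1_size big_distrl /= big_seq [X in (_ <= X)%N]big_seq.
  by apply: leq_sum => x xs; rewrite mul1n h.
have sumR : (3 * \sum_(r <- Rd) \sum_(b <- Bl) (b \in F r) <= n * (n + 2))%N.
  rewrite big_distrr /= -{1}sR; apply: sum_leq => r rR.
  rewrite sum_nat_of_bool; apply: leq_trans (bR r rR); rewrite leq_mul2l /=.
  by apply: leq_trans (count_mem_le _ uB) _; exact: count_size.
have sumB : (3 * \sum_(r <- Rd) \sum_(b <- Bl) (r \in F b) <= n * (n + 2))%N.
  rewrite exchange_big big_distrr /= -{1}sB; apply: sum_leq => b bBl.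
  rewrite sum_nat_of_bool; apply: leq_trans (bB b bBl); rewrite leq_mul2l /=.
  by apply: leq_trans (count_mem_le _ uR) _; exact: count_size.
(* A balanced hole has two vertices of each colour, hence accounts for at most 2 * 2 pairs. *)
have sumH : (\sum_(r <- Rd) \sum_(b <- Bl) \sum_(P <- H) (r \in P) * (b \in P)
    <= size H * 4)%N.
  under eq_bigr do rewrite exchange_big /=.
  rewrite exchange_big /= -sum1_size big_distrl /=.
  rewrite big_seq [X in (_ <= X)%N]big_seq; apply: leq_sum => P /hole[_ [cR cB]].
  under eq_bigr do rewrite -big_distrr /=.
  rewrite -big_distrl /= !sum_nat_of_bool mul1n -[4%N]/(2 * 2)%N.
  by apply: leq_mul; [rewrite -cR|rewrite -cB]; apply: count_mem_le.
(* The factor 3 clears the denominator of the bounds on bad pairs; what remains is that [n * n] is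
   at most [4 * n + 12 * size H]. *)
have {key} key : (3 * (n * n) <= 2 * (n * (n + 2)) + 12 * size H)%N.
  move: key; under eq_bigr do rewrite !big_split /=.
  rewrite !big_split /= -(leq_pmul2l (isT : (0 < 3)%N)) !mulnDr -/F => key.
  apply: leq_trans key _.
  apply: leq_trans (leq_add (leq_add sumR sumB) (leq_mul (leqnn 3) sumH)) _.
  by rewrite !mulnDr addnn -mul2n !mulnDr leq_add2l mulnCA mulnC.
(* Moving [4 * n] to the right-hand side before passing to [nat] avoids truncated subtraction. *)
rewrite ler_pdivrMr ?ltr0n // lerBlDr -natrM -natrD ler_nat -mulnn.
by move: (size H) key => h; clear; lia.
Qed.
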